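(* Let $k$ be an algebraically closed field of characteristic $0$ and let $\mathcal{C}$ be a self-dual fusion category of rank $4$ over $k$. Assume that $\mathrm{Irr}(\mathcal{C})=\{\mathbf{1},X,Y,Z\}$ and that $\{\mathbf{1},Z\}$ generates a Fibonacci fusion category. Then the fusion rules of $\mathcal{C}$ are determined by non-negative integers $a$ and $b$ as follows: $$X\otimes X=\mathbf{1}\oplus aX\oplus bY,\quad X\otimes Y=bX\oplus(a+b)Y\oplus Z,\quad X\otimes Z=Y,$$ $$Y\otimes Z=X\oplus Y,\quad Y\otimes Y=\mathbf{1}\oplus(a+b)X\oplus(a+2b)Y\oplus Z,\quad Z\otimes Z=\mathbf{1}\oplus Z.$$
   Context: A fusion category over $k$ is a $k$-linear semisimple rigid tensor category with finitely many isomorphism classes of simple objects, finite-dimensional morphism spaces, and simple unit object $\mathbf{1}$. $\mathrm{Irr}(\mathcal{C})$ is the set of isomorphism classes of simple objects; the rank of $\mathcal{C}$ is $|\mathrm{Irr}(\mathcal{C})|$. $\mathcal{C}$ is self-dual if $V^*\cong V$ for every simple object $V$; then the Grothendieck ring is commutative. The fusion rules are the decompositions $V\otimes W\cong\bigoplus_{U\in\mathrm{Irr}(\mathcal{C})}N_{VW}^{U}\,U$ of tensor products of simple objects, and equalities such as $X\otimes Z=Y$ mean isomorphism. $aX$ denotes the direct sum of $a$ copies of $X$. Products of simple objects not listed are determined by commutativity and by the unit. A Fibonacci fusion category is a rank $2$ fusion category with simple objects $\mathbf{1},Z$ and $Z\otimes Z=\mathbf{1}\oplus Z$; the hypothesis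 that $\{\mathbf{1},Z\}$ generates a Fibonacci fusion category means that the full subcategory of direct sums of copies of $\mathbf{1}$ and $Z$ is a fusion subcategory of $\mathcal{C}$ of this type.
   Formalization: The fusion rules are proved after possibly interchanging the names X and Y; for a fixed labeling the claim fails, e.g. in Fib⊠Fib with Z=1⊠τ, X=τ⊠τ, Y=τ⊠1, where X⊗Z=X⊕Y. *)

(* Defs.v *)
From HB Require Import structures.
From mathcomp Require Import all_boot all_order all_algebra.

Set Implicit Arguments.
Unset Strict Implicit.
Unset Printing Implicit Defensive.

Import GRing.Theory.
Local Open Scope ring_scope.

Declare Scope cat_scope.
Delimit Scope cat_scope with cat.

Reserved Notation "g \oc f" (at level 40, left associativity).
Reserved Notation "f \otm g" (at level 35, no associativity).
Reserved Notation "x \cong y" (at level 70, no associativity).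
Reserved Notation "x \oplus y" (at level 50, left associativity).
Reserved Notation "x \otimes y" (at level 40, left associativity).
Reserved Notation "n \cdot x" (at level 40, no associativity).

(* Values of [vectType k] are finite-dimensional, so finite-dimensionality of
   the morphism spaces is built into [hom]. *)
Record linearCategory (k : fieldType) := LinearCategory {
  object :> Type;
  hom : object -> object -> vectType k;
  idm : forall x, hom x x;
  compm : forall x y z, hom y z -> hom x y -> hom x z;
  compm_linearr : forall x y z (g : hom y z), linear (@compm x y z g);
  compm_linearl : forall x y z (f : hom x y),
    linear (fun g : hom y z => compm g f);
  compm_idl : forall x y (f : hom x y), compm (idm y) f = f;
  compm_idr : forall x y (f : hom x y), compm f (idm x) = f;
  compm_assoc : forall w x y z (h : hom y z) (g : hom x y) (f : hom w x),
    compm h (compm g f) = compm (compm h g) f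
}.

Arguments hom {k l} x y.
Arguments idm {k l} x.
Arguments compm {k l x y z} g f.

Notation "g \oc f" := (compm g f) : cat_scope.
Local Open Scope cat_scope.

Section LinearCategoryNotions.
Variables (k : fieldType) (C : linearCategory k).
Implicit Types w x y z : C.

Definition is_iso x y (f : hom x y) : Prop :=
  exists g : hom y x, g \oc f = idm x /\ f \oc g = idm y.

Definition isomorphic x y : Prop := exists f : hom x y, is_iso f.

Definition is_zero x : Prop :=
  forall y, (forall f : hom x y, f = 0) /\ (forall f : hom y x, f = 0).

Definition is_mono x y (f : hom x y) : Prop :=
  forall w (g h : hom w x), f \oc g = f \oc h -> g = h.

Definition is_epi x y (f : hom x y) : Prop :=
  forall z (g h : hom y z), g \oc f = h \oc f -> g = h.

Definition is_kernel w x y (f : hom x y) (i : hom w x) : Prop :=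
  f \oc i = 0 /\
  forall z (g : hom z x), f \oc g = 0 -> exists! h : hom z w, i \oc h = g.

Definition is_cokernel x y z (f : hom x y) (p : hom y z) : Prop :=
  p \oc f = 0 /\
  forall w (g : hom y w), g \oc f = 0 -> exists! h : hom z w, h \oc p = g.

Definition is_simple x : Prop :=
  ~ is_zero x /\
  forall w (i : hom w x), is_mono i -> is_zero w \/ is_iso i.

End LinearCategoryNotions.

Notation "x \cong y" := (isomorphic x y) : cat_scope.

Record additiveCategory (k : fieldType) := AdditiveCategory {
  linear_part :> linearCategory k;
  zero : linear_part;
  zeroP : is_zero zero;
  biprod : linear_part -> linear_part -> linear_part;
  inj1 : forall x y, hom x (biprod x y);
  inj2 : forall x y, hom y (biprod x y);
  prj1 : forall x y, hom (biprod x y) x;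
  prj2 : forall x y, hom (biprod x y) y;
  prj1_inj1 : forall x y, prj1 x y \oc inj1 x y = idm x;
  prj2_inj2 : forall x y, prj2 x y \oc inj2 x y = idm y;
  prj1_inj2 : forall x y, prj1 x y \oc inj2 x y = 0;
  prj2_inj1 : forall x y, prj2 x y \oc inj1 x y = 0;
  biprod_id : forall x y,
    inj1 x y \oc prj1 x y + inj2 x y \oc prj2 x y = idm (biprod x y)
}.

Arguments zero {k} a.
Arguments biprod {k a} x y.

Notation "x \oplus y" := (biprod x y) : cat_scope.

Section AdditiveCategoryNotions.
Variables (k : fieldType) (C : additiveCategory k).
Implicit Types (x y : C) (s : seq C).

Definition dsum s : C := foldr biprod (zero C) s.

Definition copies (n : nat) x : C := dsum (nseq n x).

Definition is_abelian : Prop :=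
  [/\ forall x y (f : hom x y), exists w (i : hom w x), is_kernel f i,
      forall x y (f : hom x y), exists z (p : hom y z), is_cokernel f p,
      forall x y (f : hom x y), is_mono f ->
        exists z (p : hom y z), is_kernel p f
    & forall x y (f : hom x y), is_epi f ->
        exists w (i : hom w x), is_cokernel i f].

Definition is_semisimple : Prop :=
  forall x, exists2 s,
    forall i, (i < size s)%N -> is_simple (nth (zero C) s i) & x \cong dsum s.

(* [s] lists, without repetition, representatives of the isomorphism classes
   of those simple objects that satisfy [P]. *)
Definition lists_simples (P : C -> Prop) s : Prop :=
  [/\ forall i, (i < size s)%N ->
        is_simple (nth (zero C) s i) /\ P (nth (zero C) s i),
      forall i j, (i < size s)%N -> (j < size s)%N ->
        nth (zero C) s i \cong nth (zero C) s j -> i = j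
    & forall x, is_simple x -> P x ->
        exists2 i, (i < size s)%N & x \cong nth (zero C) s i].

Definition is_Irr s : Prop := lists_simples (fun=> True) s.

Definition has_rank (n : nat) : Prop := exists2 s, size s = n & is_Irr s.

End AdditiveCategoryNotions.

Notation "n \cdot x" := (copies n x) : cat_scope.

Record monoidalCategory (k : fieldType) := MonoidalCategory {
  additive_part :> additiveCategory k;
  unit_obj : additive_part;
  tens : additive_part -> additive_part -> additive_part;
  tensm : forall x x' y y', hom x x' -> hom y y' ->
    hom (tens x y) (tens x' y');
  tensm_linearr : forall x x' y y' (f : hom x x'),
    linear (@tensm x x' y y' f);
  tensm_linearl : forall x x' y y' (g : hom y y'),
    linear (fun f : hom x x' => tensm f g);
  tensm_id : forall x y, tensm (idm x) (idm y) = idm (tens x y);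
  tensm_comp : forall x x' x'' y y' y''
      (f' : hom x' x'') (f : hom x x') (g' : hom y' y'') (g : hom y y'),
    tensm (f' \oc f) (g' \oc g) = tensm f' g' \oc tensm f g;
  associator : forall x y z, hom (tens (tens x y) z) (tens x (tens y z));
  associatorV : forall x y z, hom (tens x (tens y z)) (tens (tens x y) z);
  associatorK : forall x y z,
    associatorV x y z \oc associator x y z = idm _;
  associatorVK : forall x y z,
    associator x y z \oc associatorV x y z = idm _;
  associator_nat : forall x x' y y' z z'
      (f : hom x x') (g : hom y y') (h : hom z z'),
    associator x' y' z' \oc tensm (tensm f g) h =
    tensm f (tensm g h) \oc associator x y z;
  lunitor : forall x, hom (tens unit_obj x) x;
  lunitorV : forall x, hom x (tens unit_obj x);
  lunitorK : forall x, lunitorV x \oc lunitor x = idm _;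
  lunitorVK : forall x, lunitor x \oc lunitorV x = idm _;
  lunitor_nat : forall x x' (f : hom x x'),
    lunitor x' \oc tensm (idm unit_obj) f = f \oc lunitor x;
  runitor : forall x, hom (tens x unit_obj) x;
  runitorV : forall x, hom x (tens x unit_obj);
  runitorK : forall x, runitorV x \oc runitor x = idm _;
  runitorVK : forall x, runitor x \oc runitorV x = idm _;
  runitor_nat : forall x x' (f : hom x x'),
    runitor x' \oc tensm f (idm unit_obj) = f \oc runitor x;
  pentagon : forall w x y z,
    associator w x (tens y z) \oc associator (tens w x) y z =
    tensm (idm w) (associator x y z) \oc associator w (tens x y) z
      \oc tensm (associator w x y) (idm z);
  triangle : forall x y,
    tensm (idm x) (lunitor y) \oc associator x unit_obj y =
    tensm (runitor x) (idm y)
}.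

Arguments unit_obj {k} m.
Arguments tens {k m} x y.
Arguments tensm {k m x x' y y'} f g.
Arguments associator {k m} x y z.
Arguments associatorV {k m} x y z.
Arguments lunitor {k m} x.
Arguments lunitorV {k m} x.
Arguments runitor {k m} x.
Arguments runitorV {k m} x.

Notation "x \otimes y" := (tens x y) : cat_scope.
Notation "f \otm g" := (tensm f g) : cat_scope.

(* [ev] and [coev] exhibit [x'] as a left dual of [x], equivalently [x] as a
   right dual of [x']: both zigzag composites are identities. *)
Definition duality (k : fieldType) (C : monoidalCategory k) (x x' : C)
    (ev : hom (x' \otimes x) (unit_obj C))
    (coev : hom (unit_obj C) (x \otimes x')) : Prop :=
  runitor x \oc (idm x \otm ev) \oc associator x x' x
    \oc (coev \otm idm x) \oc lunitorV x = idm x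
  /\
  lunitor x' \oc (ev \otm idm x') \oc associatorV x' x x'
    \oc (idm x' \otm coev) \oc runitorV x' = idm x'.

Record rigidCategory (k : fieldType) := RigidCategory {
  monoidal_part :> monoidalCategory k;
  ldual : monoidal_part -> monoidal_part;
  left_ev : forall x, hom (ldual x \otimes x) (unit_obj monoidal_part);
  left_coev : forall x, hom (unit_obj monoidal_part) (x \otimes ldual x);
  ldualP : forall x, duality (left_ev x) (left_coev x);
  rdual : monoidal_part -> monoidal_part;
  right_ev : forall x, hom (x \otimes rdual x) (unit_obj monoidal_part);
  right_coev : forall x, hom (unit_obj monoidal_part) (rdual x \otimes x);
  rdualP : forall x, duality (right_ev x) (right_coev x)
}.

Arguments ldual {k r} x.
Arguments rdual {k r} x.

Record fusionCategory (k : fieldType) := FusionCategory {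
  rigid_part :> rigidCategory k;
  fusion_abelian : is_abelian rigid_part;
  fusion_semisimple : is_semisimple rigid_part;
  fusion_finite : exists n, has_rank rigid_part n;
  fusion_unit_simple : is_simple (unit_obj rigid_part)
}.

Section FusionCategoryNotions.
Variables (k : fieldType) (C : fusionCategory k).

Definition self_dual : Prop := forall x : C, is_simple x -> ldual x \cong x.

(* The full subcategory on the objects satisfying [P] is a fusion subcategory:
   it is replete and inherits the additive, monoidal and rigid structures, and
   closure under direct summands makes it an abelian semisimple subcategory
   whose simple objects are the simple objects of [C] that it contains. *)
Record fusion_subcategory (P : C -> Prop) : Prop := FusionSubcategory {
  fsub_iso : forall x y, x \cong y -> P x -> P y;
  fsub_zero : P (zero C);
  fsub_biprod : forall x y, P x -> P y -> P (x \oplus y);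
  fsub_summand : forall x y, P (x \oplus y) -> P x;
  fsub_unit : P (unit_obj C);
  fsub_tens : forall x y, P x -> P y -> P (x \otimes y);
  fsub_ldual : forall x, P x -> P (ldual x);
  fsub_rdual : forall x, P x -> P (rdual x)
}.

Definition sum_of_copies (z x : C) : Prop :=
  exists m n : nat, x \cong m \cdot unit_obj C \oplus n \cdot z.

Definition generates_Fibonacci (z : C) : Prop :=
  [/\ fusion_subcategory (sum_of_copies z),
      lists_simples (sum_of_copies z) [:: unit_obj C; z]
    & z \otimes z \cong unit_obj C \oplus z].

End FusionCategoryNotions.

(* Main.v *)
From HB Require Import structures.
From mathcomp Require Import all_boot all_order all_algebra.
From mathcomp Require Import zify.
Require Import Defs.

(** The theorem is a computation in the Grothendieck ring; the work lies in
    passing from isomorphisms of objects to natural numbers and back.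

    The dictionary is the multiplicity [dim (hom U V)] of a simple object [U]
    in an object [V]. By Schur's lemma ([dim_hom_simple]) it is a Kronecker
    delta when [V] is simple too, so by semisimplicity every function of
    objects that respects isomorphisms and direct sums is determined by
    multiplicities ([additive_decomposition]), and objects with the same
    multiplicities are isomorphic ([iso_dim_hom]).

    For self-dual simple objects the multiplicity of [W] in [U \otimes V] is a
    fully symmetric function of [U], [V] and [W]. Duality provides one exchange
    ([fusion_swap]): bending the strand [V] embeds [hom (U \otimes V) W] into
    [hom U (W \otimes V)] ([transpose_inj]), and symmetry of dimensions turns
    the inequality into an equality. The cyclic symmetry ([fusion_rotate])
    comes from associativity, both sides being the multiplicity of the unit in
    the triple product. In particular the fusion rules are commutative.

    It remains to solve for the rules. Symmetry shows that tensoring with [Z]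
    preserves the span of [X] and [Y] and acts there by a symmetric matrix [M]
    of natural numbers with [M * M = 1 + M]. The only such matrices have zero
    and one on the diagonal and ones off it ([tens_Z_coefficients]); after
    exchanging [X] and [Y] if need be, [X \otimes Z = Y] and
    [Y \otimes Z = X + Y]. With [a] and [b] the multiplicities of [X] and [Y]
    in [X \otimes X], writing [Y] as [X \otimes Z] computes the products
    [X \otimes Y] and [Y \otimes Y] from [X \otimes X] by associativity
    ([fusion_rules_oriented]). *)

Set Implicit Arguments.
Unset Strict Implicit.
Unset Printing Implicit Defensive.

Import GRing.Theory.

Local Open Scope cat_scope.

(** * Dimensions of vector spaces and eigenvectors *)

Section LinearAlgebra.
Import VectorInternalTheory.
Local Open Scope ring_scope.

Lemma leq_dim_linear (k : fieldType) (U V : vectType k) (f : U -> V) :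
  linear f -> (forall u, f u = 0 -> u = 0) -> (dim U <= dim V)%N.
Proof.
move=> lin_f ker_f.
pose fL := GRing.isLinear.Build k U V *:%R f lin_f.
pose F : {linear U -> V} := HB.pack f fL.
have kerF : (lker (linfun F) == 0)%VS.
  apply/lker0P => u v; rewrite !lfunE /= => eq_uv; apply/eqP.
  rewrite -subr_eq0; apply/eqP/ker_f.
  by rewrite -[f]/(F : _ -> _) linearB /= eq_uv subrr.
rewrite -!dimvf -(limg_dim_eq (f := linfun F) (U := fullv)).
  by rewrite dimvS ?subvf.
by rewrite (eqP kerF) capv0.
Qed.

Lemma linear_eigenvector (k : closedFieldType) (V : vectType k) (f : V -> V) :
  linear f -> (0 < dim V)%N -> exists a v, v <> 0 /\ f v = a *: v.
Proof.
move=> lin_f dimV.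
pose fL := GRing.isLinear.Build k V V *:%R f lin_f.
pose F : {linear V -> V} := HB.pack f fL.
pose A := lin1_mx (v2r \o F \o r2v).
have [a rAa] : exists a, root (char_poly A) a.
  by apply/closed_rootP; rewrite size_char_poly; case: (dim V) dimV.
have /eigenvalueP[u uA u_neq0] : eigenvalue A a by rewrite eigenvalue_root_char.
exists a, (r2v u); split.
  by move=> u0; case/eqP: u_neq0; apply: r2v_inj; rewrite u0 linear0.
apply: v2r_inj.
by rewrite linearZ /= r2vK -uA mul_rV_lin1.
Qed.

End LinearAlgebra.

(** * Linear categories and Schur's lemma *)

Section LinearCategories.
Local Open Scope ring_scope.
Variables (k : fieldType) (C : linearCategory k).
Implicit Types w x y z : C.

(** A named function, so that it can carry the structure of a linear map. *)
Definition precomp x y z (f : hom x y) (g : hom y z) := g \oc f.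

HB.instance Definition _ x y z (g : hom y z) :=
  GRing.isLinear.Build k (hom x y) (hom x z) *:%R (compm g)
    (compm_linearr g).

HB.instance Definition _ x y z (f : hom x y) :=
  GRing.isLinear.Build k (hom y z) (hom x z) *:%R (precomp f)
    (compm_linearl f).

Lemma compm0 x y z (g : hom y z) : g \oc (0 : hom x y) = 0.
Proof. exact: linear0. Qed.

Lemma comp0m x y z (f : hom x y) : (0 : hom y z) \oc f = 0.
Proof. exact: (linear0 (precomp f)). Qed.

Lemma compmD x y z (g : hom y z) (f f' : hom x y) :
  g \oc (f + f') = g \oc f + g \oc f'.
Proof. exact: linearD. Qed.

Lemma compDm x y z (g g' : hom y z) (f : hom x y) :
  (g + g') \oc f = g \oc f + g' \oc f.
Proof. exact: (linearD (precomp f)). Qed.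

Lemma compmB x y z (g : hom y z) (f f' : hom x y) :
  g \oc (f - f') = g \oc f - g \oc f'.
Proof. exact: linearB. Qed.

Lemma compBm x y z (g g' : hom y z) (f : hom x y) :
  (g - g') \oc f = g \oc f - g' \oc f.
Proof. exact: (linearB (precomp f)). Qed.

Lemma compZm x y z a (g : hom y z) (f : hom x y) :
  (a *: g) \oc f = a *: (g \oc f).
Proof. exact: (linearZZ (precomp f)). Qed.

Lemma isomorphic_refl x : x \cong x.
Proof. by exists (idm x), (idm x); rewrite compm_idl. Qed.

Lemma isomorphic_sym x y : x \cong y -> y \cong x.
Proof. by case=> f [g [gf fg]]; exists g, f. Qed.

Lemma isomorphic_trans y x z : x \cong y -> y \cong z -> x \cong z.
Proof.
case=> f [f' [f'f ff']] [g [g' [g'g gg']]]; exists (g \oc f), (f' \oc g').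
split; rewrite compm_assoc.
  by rewrite -(compm_assoc f' g') g'g compm_idr.
by rewrite -(compm_assoc g f) ff' compm_idr.
Qed.

Lemma is_zero_id x : idm x = 0 -> is_zero x.
Proof.
move=> x0 y; split=> f; first by rewrite -[f]compm_idr x0 compm0.
by rewrite -[f]compm_idl x0 comp0m.
Qed.

Lemma leq_dim_postcomp w x y (f : hom x y) (g : hom y x) :
  g \oc f = idm x -> (dim (hom w x) <= dim (hom w y))%N.
Proof.
move=> gf; apply: (leq_dim_linear (compm_linearr f)) => u fu.
by rewrite -[u]compm_idl -gf -compm_assoc fu compm0.
Qed.

Lemma leq_dim_precomp w x y (f : hom x y) (g : hom y x) :
  g \oc f = idm x -> (dim (hom x w) <= dim (hom y w))%N.
Proof.
move=> gf; apply: (leq_dim_linear (compm_linearl g)) => u ug.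
by rewrite -[u]compm_idr -gf compm_assoc ug comp0m.
Qed.

Lemma dim_hom_isor w x y : x \cong y -> dim (hom w x) = dim (hom w y).
Proof.
case=> f [g [gf fg]]; apply/eqP.
by rewrite eqn_leq (leq_dim_postcomp w gf) (leq_dim_postcomp w fg).
Qed.

Lemma dim_hom_isol w x y : x \cong y -> dim (hom x w) = dim (hom y w).
Proof.
case=> f [g [gf fg]]; apply/eqP.
by rewrite eqn_leq (leq_dim_precomp w gf) (leq_dim_precomp w fg).
Qed.

(** The kernel of a nonzero map out of a simple object is a subobject that
   cannot be everything, hence vanishes; the map is then itself a nonzero
   subobject of its simple target. *)
Lemma simple_hom_iso x y (f : hom x y) :
    (exists w (i : hom w x), is_kernel f i) ->
  is_simple x -> is_simple y -> f <> 0 -> is_iso f.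
Proof.
move=> [w [i [fi ker_i]]] [x_neq0 sx] [_ sy] f_neq0.
have mono_i : is_mono i.
  move=> v g h eq_gh.
  have [l [_ uniq_l]] := ker_i v (i \oc h)
    (ltac:(by rewrite compm_assoc fi comp0m)).
  by rewrite -(uniq_l g eq_gh) -(uniq_l h erefl).
have zero_w : is_zero w.
  have [//|[j [_ ij]]] := sx w i mono_i.
  by case: f_neq0; rewrite -[f]compm_idr -ij compm_assoc fi comp0m.
have mono_f : is_mono f.
  move=> v g h eq_gh.
  have [l [il _]] := ker_i v (g - h)
    (ltac:(by rewrite compmB eq_gh subrr)).
  have [_ /(_ l) l0] := zero_w v.
  by move: il; rewrite l0 compm0 => /esym/eqP; rewrite subr_eq0 => /eqP.
by have [/x_neq0|] := sy x f mono_f.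
Qed.

End LinearCategories.

(** Over an algebraically closed field an endomorphism of a simple object has
   an eigenvalue, and subtracting it leaves a non-invertible endomorphism,
   which is zero. *)
Lemma dim_hom_simple (k : closedFieldType) (C : linearCategory k) (x y : C) :
    (forall f : hom x y, exists w (i : hom w x), is_kernel f i) ->
    (forall f : hom x x, exists w (i : hom w x), is_kernel f i) ->
  is_simple x -> is_simple y ->
  (x \cong y -> dim (hom x y) = 1) /\ (~ x \cong y -> dim (hom x y) = 0).
Proof.
move=> kerxy kerxx sx sy; split=> [iso_xy | not_iso]; last first.
  apply/eqP; rewrite -leqn0 -dimvf leqn0 dimv_eq0 -subv0; apply/subvP => f _.
  rewrite memv0; apply/negP => /negP/eqP f_neq0.
  by apply: not_iso; exists f; apply: simple_hom_iso (kerxy f) sx sy f_neq0.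
rewrite -(dim_hom_isor x iso_xy).
have id_neq0 : idm x <> 0%R by move/is_zero_id; case: sx.
have dim_gt0 : 0 < dim (hom x x).
  rewrite lt0n -dimvf dimv_eq0; apply/eqP => h0; apply: id_neq0.
  by apply/eqP; rewrite -memv0 -h0 memvf.
suff -> : dim (hom x x) = \dim <[idm x]>%VS.
  by rewrite dim_vline; case: eqP.
rewrite -dimvf; congr (\dim _); apply/eqP; rewrite eqEsubv subvf andbT.
apply/subvP => f _; apply/vlineP.
have [a [g [g_neq0 fg]]] := linear_eigenvector (compm_linearr f) dim_gt0.
exists a; apply/eqP; rewrite -subr_eq0; apply/eqP.
have [h [_ gh]] := simple_hom_iso (kerxx g) sx sx g_neq0.
rewrite -[LHS]compm_idr -[X in _ \oc X]gh compm_assoc compBm compZm compm_idl.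
by rewrite fg subrr comp0m.
Qed.

(** * Biproducts *)

Section Biproducts.
Local Open Scope ring_scope.
Variables (k : fieldType) (C : additiveCategory k).
Implicit Types (p q w x y z : C).

(** Stated for an arbitrary object [p], so that the same characterization
   serves reassociated sums and tensor products of sums. *)
Definition is_biprod p x y : Prop :=
  exists (i1 : hom x p) (i2 : hom y p) (p1 : hom p x) (p2 : hom p y),
    [/\ p1 \oc i1 = idm x, p2 \oc i2 = idm y, p1 \oc i2 = 0, p2 \oc i1 = 0
      & i1 \oc p1 + i2 \oc p2 = idm p].

Lemma is_biprod_biprod x y : is_biprod (x \oplus y) x y.
Proof.
exists (inj1 x y), (inj2 x y), (prj1 x y), (prj2 x y); split.
- exact: prj1_inj1.
- exact: prj2_inj2.
- exact: prj1_inj2.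
- exact: prj2_inj1.
- exact: biprod_id.
Qed.

Lemma is_biprod_iso p q x x' y y' :
  is_biprod p x y -> is_biprod q x' y' -> x \cong x' -> y \cong y' ->
  p \cong q.
Proof.
move=> [i1 [i2 [p1 [p2 [p1i1 p2i2 p1i2 p2i1 ipE]]]]].
move=> [j1 [j2 [q1 [q2 [q1j1 q2j2 q1j2 q2j1 jqE]]]]].
move=> [f [f' [f'f ff']]] [g [g' [g'g gg']]].
exists (j1 \oc (f \oc p1) + j2 \oc (g \oc p2)),
       (i1 \oc (f' \oc q1) + i2 \oc (g' \oc q2)).
split; rewrite !compmD !compDm -!compm_assoc.
- rewrite !(compm_assoc q1) !(compm_assoc q2) q1j1 q2j1 q1j2 q2j2.
  rewrite !compm_idl !comp0m !compm0 addr0 add0r.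
  by rewrite !(compm_assoc f') !(compm_assoc g') f'f g'g !compm_idl.
- rewrite !(compm_assoc p1) !(compm_assoc p2) p1i1 p2i1 p1i2 p2i2.
  rewrite !compm_idl !comp0m !compm0 addr0 add0r.
  by rewrite !(compm_assoc f) !(compm_assoc g) ff' gg' !compm_idl.
Qed.

Lemma biprod_cong x x' y y' :
  x \cong x' -> y \cong y' -> x \oplus y \cong x' \oplus y'.
Proof. exact: is_biprod_iso (is_biprod_biprod _ _) (is_biprod_biprod _ _). Qed.

Lemma biprodCA x y z : x \oplus (y \oplus z) \cong y \oplus (x \oplus z).
Proof.
apply: is_biprod_iso (is_biprod_biprod _ _) (isomorphic_refl _)
  (isomorphic_refl _).
exists (inj2 _ _ \oc inj1 _ _),
  (inj1 _ _ \oc prj1 _ _ + inj2 _ _ \oc (inj2 _ _ \oc prj2 _ _)),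
  (prj1 _ _ \oc prj2 _ _),
  (inj1 _ _ \oc prj1 _ _ + inj2 _ _ \oc (prj2 _ _ \oc prj2 _ _)).
have K11 a b w (f : hom w a) : prj1 a b \oc (inj1 a b \oc f) = f.
  by rewrite compm_assoc prj1_inj1 compm_idl.
have K22 a b w (f : hom w b) : prj2 a b \oc (inj2 a b \oc f) = f.
  by rewrite compm_assoc prj2_inj2 compm_idl.
have K12 a b w (f : hom w b) : prj1 a b \oc (inj2 a b \oc f) = 0.
  by rewrite compm_assoc prj1_inj2 comp0m.
have K21 a b w (f : hom w a) : prj2 a b \oc (inj1 a b \oc f) = 0.
  by rewrite compm_assoc prj2_inj1 comp0m.
have simplE := (prj1_inj1, prj2_inj2, prj1_inj2, prj2_inj1, K11, K22, K12, K21,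
                compm_idr, compm0, comp0m, addr0, add0r).
split; rewrite ?compmD ?compDm ?compmD -?compm_assoc ?simplE //.
  exact: biprod_id.
rewrite addrCA -compmD !compm_assoc -compDm -[RHS]biprod_id; congr (_ + _).
by rewrite -[X in _ = _ \oc X]compm_idl -biprod_id compDm compmD -!compm_assoc.
Qed.

Lemma dim_hom_biprodr w x y :
  dim (hom w (x \oplus y)) = (dim (hom w x) + dim (hom w y))%N.
Proof.
apply/eqP; rewrite eqn_leq; apply/andP; split.
  pose f (u : hom w (x \oplus y)) := (prj1 x y \oc u, prj2 x y \oc u).
  apply: (@leq_dim_linear k _ (hom w x * hom w y)%type f).
    by move=> a u v; rewrite /f !linearP.
  by move=> u [u1 u2]; rewrite -[u]compm_idl -biprod_id compDm -!compm_assoc u1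
    u2 !compm0 addr0.
pose f (u : hom w x * hom w y) := inj1 x y \oc u.1 + inj2 x y \oc u.2.
apply: (@leq_dim_linear k (hom w x * hom w y)%type _ f).
  by move=> a u v; rewrite /f !linearP /= scalerDr addrACA.
move=> [u1 u2]; rewrite /f /= => fu0.
have := congr1 (compm (prj1 x y)) fu0; have := congr1 (compm (prj2 x y)) fu0.
rewrite !compmD !compm0 !compm_assoc prj1_inj1 prj2_inj2 prj1_inj2 prj2_inj1.
by rewrite !compm_idl !comp0m addr0 add0r => -> ->.
Qed.

Lemma dim_hom_biprodl w x y :
  dim (hom (x \oplus y) w) = (dim (hom x w) + dim (hom y w))%N.
Proof.
apply/eqP; rewrite eqn_leq; apply/andP; split.
  pose f (u : hom (x \oplus y) w) := (u \oc inj1 x y, u \oc inj2 x y).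
  apply: (@leq_dim_linear k _ (hom x w * hom y w)%type f).
    by move=> a u v; rewrite /f !compm_linearl.
  by move=> u [u1 u2]; rewrite -[u]compm_idr -biprod_id compmD !compm_assoc u1
    u2 !comp0m addr0.
pose f (u : hom x w * hom y w) := u.1 \oc prj1 x y + u.2 \oc prj2 x y.
apply: (@leq_dim_linear k (hom x w * hom y w)%type _ f).
  by move=> a u v; rewrite /f /= !compm_linearl scalerDr addrACA.
move=> [u1 u2]; rewrite /f /= => fu0.
have := congr1 (precomp (inj1 x y)) fu0.
have := congr1 (precomp (inj2 x y)) fu0.
rewrite /precomp !compDm !comp0m -!compm_assoc.
rewrite prj1_inj1 prj2_inj2 prj1_inj2 prj2_inj1.
by rewrite !compm_idr !compm0 addr0 add0r => -> ->.
Qed.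

(** A function that, like the dimension of a Hom space, descends to a morphism
   from the Grothendieck group. *)
Definition additive_on_objects (phi : C -> nat) : Prop :=
  (forall x y, x \cong y -> phi x = phi y) /\
  (forall x y, phi (x \oplus y) = (phi x + phi y)%N).

Lemma additive_dim_homr w : additive_on_objects (fun x => dim (hom w x)).
Proof. by split; [exact: dim_hom_isor | exact: dim_hom_biprodr]. Qed.

Lemma additive_dim_homl w : additive_on_objects (fun x => dim (hom x w)).
Proof. by split; [exact: dim_hom_isol | exact: dim_hom_biprodl]. Qed.

(** The zero object is isomorphic to its own double. *)
Lemma additive_zero phi : additive_on_objects phi -> phi (zero C) = 0%N.
Proof.
move=> [phi_iso phiD].
have hom0 (f g : hom (zero C) (zero C)) : f = g.
  by have [h _] := @zeroP _ C (zero C); rewrite (h f) (h g).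
have : zero C \cong zero C \oplus zero C.
  apply: is_biprod_iso (is_biprod_biprod _ _) (isomorphic_refl _)
    (isomorphic_refl _).
  by exists 0, 0, 0, 0; split; apply: hom0.
by move/phi_iso; rewrite phiD; lia.
Qed.

Lemma additive_copies phi n x :
  additive_on_objects phi -> phi (n \cdot x) = (n * phi x)%N.
Proof.
move=> phi_add; elim: n => [|n IHn]; first exact: additive_zero.
by case: (phi_add) => _ phiD; rewrite [LHS]phiD -/(copies n x) IHn mulSn.
Qed.

End Biproducts.

(** * Objects of a semisimple category and their multiplicities *)

Section Semisimple.
Variables (k : closedFieldType) (C : additiveCategory k).
Hypothesis abC : is_abelian C.
Hypothesis ssC : is_semisimple C.
Variable s : seq C.
Hypothesis irr_s : is_Irr s.
Implicit Types (w x y z : C) (r : seq 'I_(size s)).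

Local Notation irr i := (nth (zero C) s i).

Lemma simple_irr (i : 'I_(size s)) : is_simple (irr i).
Proof. by case: irr_s => /(_ i (ltn_ord i))[]. Qed.

Lemma dim_hom_simples x y : is_simple x -> is_simple y ->
  (x \cong y -> dim (hom x y) = 1) /\ (~ x \cong y -> dim (hom x y) = 0).
Proof. by case: abC => ker _ _ _; apply: dim_hom_simple. Qed.

Lemma dim_hom_irr (i j : 'I_(size s)) :
  dim (hom (irr i) (irr j)) = (i == j).
Proof.
have [iso_ij not_iso_ij] := dim_hom_simples (simple_irr i) (simple_irr j).
case: eqP => [eq_ij | neq_ij].
  by apply: iso_ij; rewrite eq_ij; apply: isomorphic_refl.
apply: not_iso_ij => iso_ij'; have [_ inj_s _] := irr_s.
exact/neq_ij/val_inj/(inj_s _ _ (ltn_ord i) (ltn_ord j) iso_ij').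
Qed.

Lemma dsum_irr x : exists r, x \cong dsum [seq irr (i : 'I_(size s)) | i <- r].
Proof.
have [t simple_t iso_xt] := ssC x.
suff [r iso_tr] : exists r, dsum t \cong dsum [seq irr (val i) | i <- r].
  by exists r; apply: isomorphic_trans iso_xt iso_tr.
elim: t simple_t {x iso_xt} => [|x t IHt] simple_t.
  by exists [::]; apply: isomorphic_refl.
have [r iso_tr] := IHt (fun i => simple_t i.+1).
case: irr_s => _ _ /(_ x (simple_t 0 isT) I)[i lt_i iso_xi].
by exists (Ordinal lt_i :: r); apply: biprod_cong.
Qed.

Lemma additive_dsum phi r : additive_on_objects phi ->
  phi (dsum [seq irr (val i) | i <- r]) =
  \sum_(i < size s) count_mem i r * phi (irr i).
Proof.
move=> phi_add; elim: r => [|j r IHr] /=.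
  by rewrite additive_zero // big1.
case: (phi_add) => _ ->; rewrite IHr (eq_bigr _ (fun i _ => mulnDl _ _ _)).
rewrite big_split /=; congr (_ + _).
rewrite (bigD1 j) //= eqxx mul1n big1 ?addn0 //.
by move=> i /negPf; rewrite eq_sym => ->.
Qed.

Lemma dim_hom_dsum r (i : 'I_(size s)) :
  dim (hom (irr i) (dsum [seq irr (val j) | j <- r])) = count_mem i r.
Proof.
rewrite (additive_dsum _ (additive_dim_homr (irr i))) (bigD1 i) //=.
rewrite dim_hom_irr eqxx muln1 big1 ?addn0 // => j.
by rewrite dim_hom_irr eq_sym => /negPf->; rewrite muln0.
Qed.

(** The classes of the simple objects generate the Grothendieck group. *)
Lemma additive_decomposition phi x : additive_on_objects phi ->
  phi x = \sum_(i < size s) dim (hom (irr i) x) * phi (irr i).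
Proof.
move=> phi_add; have [r iso_xr] := dsum_irr x.
have [phi_iso _] := phi_add.
rewrite (phi_iso _ _ iso_xr) additive_dsum //; apply: eq_bigr => i _.
by rewrite (dim_hom_isor _ iso_xr) dim_hom_dsum.
Qed.

Lemma perm_dsum r r' : perm_eq r r' ->
  dsum [seq irr (val i) | i <- r] \cong dsum [seq irr (val i) | i <- r'].
Proof.
elim: r r' => [|i r IHr] r' eq_rr'.
  by rewrite (size0nil (esym (perm_size eq_rr'))); apply: isomorphic_refl.
have r'i : i \in r' by rewrite -(perm_mem eq_rr') mem_head.
case/splitPr: r'i eq_rr' => r1 r2 eq_rr'.
apply: (@isomorphic_trans _ _
  (irr i \oplus dsum [seq irr (val j) | j <- r1 ++ r2])).
  apply: biprod_cong (isomorphic_refl _) (IHr _ _).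
  by rewrite -(perm_cons i) (permPl eq_rr') perm_catC /= perm_cons perm_catC.
elim: r1 {IHr r eq_rr'} => [|j r1 IHr1] /=; first exact: isomorphic_refl.
apply: isomorphic_trans (biprodCA _ _ _) _.
exact: biprod_cong (isomorphic_refl _) IHr1.
Qed.

(** Multiplicities recover the list of simple summands up to order. *)
Lemma iso_dim_hom x y :
    (forall i, i < size s -> dim (hom (irr i) x) = dim (hom (irr i) y)) ->
  x \cong y.
Proof.
move=> eq_dim; have [r iso_xr] := dsum_irr x; have [t iso_yt] := dsum_irr y.
apply: (isomorphic_trans iso_xr).
apply: (isomorphic_trans _ (isomorphic_sym iso_yt)).
apply: perm_dsum; apply/allP => i _ /=; apply/eqP.
rewrite -!dim_hom_dsum.
by rewrite -(dim_hom_isor _ iso_xr) -(dim_hom_isor _ iso_yt) eq_dim.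
Qed.

(** Both dimensions are the sum over the simple objects of the products of
   their multiplicities in [x] and in [y]. *)
Lemma dim_homC x y : dim (hom x y) = dim (hom y x).
Proof.
rewrite (additive_decomposition x (additive_dim_homl y)).
rewrite (additive_decomposition x (additive_dim_homr y)).
apply: eq_bigr => i _; congr (_ * _).
rewrite (additive_decomposition y (additive_dim_homl (irr i))).
rewrite (bigD1 i) //= dim_hom_irr eqxx muln1 big1 ?addn0 // => j.
by rewrite dim_hom_irr => /negPf->; rewrite muln0.
Qed.

End Semisimple.

(** * Tensor products and duality *)

Section Monoidal.
Local Open Scope ring_scope.
Variables (k : fieldType) (C : monoidalCategory k).
Implicit Types (w x y z : C).
Local Notation one := (unit_obj C).

Lemma tens_cong x x' y y' :
  x \cong x' -> y \cong y' -> x \otimes y \cong x' \otimes y'.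
Proof.
move=> [f [f' [f'f ff']]] [g [g' [g'g gg']]].
exists (f \otm g), (f' \otm g').
by rewrite -!tensm_comp f'f ff' g'g gg' !tensm_id.
Qed.

Lemma tens_assoc x y z : (x \otimes y) \otimes z \cong x \otimes (y \otimes z).
Proof.
exists (associator x y z), (associatorV x y z).
by rewrite associatorK associatorVK.
Qed.

Lemma unit_tens x : one \otimes x \cong x.
Proof. by exists (lunitor x), (lunitorV x); rewrite lunitorK lunitorVK. Qed.

Lemma tens_unit x : x \otimes one \cong x.
Proof. by exists (runitor x), (runitorV x); rewrite runitorK runitorVK. Qed.

Lemma tensmD x x' y y' (f : hom x x') (g g' : hom y y') :
  f \otm (g + g') = f \otm g + f \otm g'.
Proof. by have := tensm_linearr f 1 g g'; rewrite !scale1r. Qed.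

Lemma tensDm x x' y y' (f f' : hom x x') (g : hom y y') :
  (f + f') \otm g = f \otm g + f' \otm g.
Proof. by have := tensm_linearl g 1 f f'; rewrite !scale1r. Qed.

Lemma tensm0 x x' y y' (f : hom x x') : f \otm (0 : hom y y') = 0.
Proof. by apply: (addrI (f \otm 0)); rewrite -tensmD !addr0. Qed.

Lemma tens0m x x' y y' (g : hom y y') : (0 : hom x x') \otm g = 0.
Proof. by apply: (addrI (0 \otm g)); rewrite -tensDm !addr0. Qed.

Lemma tens_biprodl x y z :
  (x \oplus y) \otimes z \cong (x \otimes z) \oplus (y \otimes z).
Proof.
apply: is_biprod_iso (is_biprod_biprod _ _) (isomorphic_refl _)
  (isomorphic_refl _).
exists (inj1 x y \otm idm z), (inj2 x y \otm idm z),
  (prj1 x y \otm idm z), (prj2 x y \otm idm z).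
split; rewrite -!tensm_comp ?compm_idl;
  rewrite ?prj1_inj1 ?prj2_inj2 ?prj1_inj2 ?prj2_inj1.
- exact: tensm_id.
- exact: tensm_id.
- exact: tens0m.
- exact: tens0m.
- by rewrite -tensDm biprod_id tensm_id.
Qed.

Lemma tens_biprodr x y z :
  z \otimes (x \oplus y) \cong (z \otimes x) \oplus (z \otimes y).
Proof.
apply: is_biprod_iso (is_biprod_biprod _ _) (isomorphic_refl _)
  (isomorphic_refl _).
exists (idm z \otm inj1 x y), (idm z \otm inj2 x y),
  (idm z \otm prj1 x y), (idm z \otm prj2 x y).
split; rewrite -!tensm_comp ?compm_idl;
  rewrite ?prj1_inj1 ?prj2_inj2 ?prj1_inj2 ?prj2_inj1.
- exact: tensm_id.
- exact: tensm_id.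
- exact: tensm0.
- exact: tensm0.
- by rewrite -tensmD biprod_id tensm_id.
Qed.

Lemma additive_tensl phi z : additive_on_objects phi ->
  additive_on_objects (fun x => phi (x \otimes z)).
Proof.
move=> [phi_iso phiD]; split=> [x y iso_xy | x y].
  exact: phi_iso (tens_cong iso_xy (isomorphic_refl z)).
by rewrite (phi_iso _ _ (tens_biprodl x y z)).
Qed.

Lemma additive_tensr phi z : additive_on_objects phi ->
  additive_on_objects (fun x => phi (z \otimes x)).
Proof.
move=> [phi_iso phiD]; split=> [x y iso_xy | x y].
  exact: phi_iso (tens_cong (isomorphic_refl z) iso_xy).
by rewrite (phi_iso _ _ (tens_biprodr x y z)).
Qed.

Section Transposition.
Variables x x' : C.
Variables (ev : hom (x' \otimes x) one) (coev : hom one (x \otimes x')).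
Hypothesis dual_xx' : duality ev coev.

Definition transpose w z (f : hom (w \otimes x) z) : hom w (z \otimes x') :=
  f \otm idm x' \oc (associatorV w x x' \oc (idm w \otm coev \oc runitorV w)).

(** The zigzag identity tensored on the left with [w]. The unit stays as an
   explicit right factor, so that only the pentagon and the triangle of the
   monoidal structure are needed to move [w] out of the way. *)
Lemma zigzag_tensl w :
  idm (w \otimes x) \otm ev \oc associator (w \otimes x) x' x
    \oc ((associatorV w x x' \oc (idm w \otm coev \oc runitorV w)) \otm idm x)
  = associatorV w x one \oc (idm w \otm runitorV x).
Proof.
have [zigzag _] := dual_xx'.
have runitorV_zigzag : runitorV x =
    (idm x \otm ev) \oc associator x x' x \oc (coev \otm idm x) \oc lunitorV x.
  rewrite -[LHS]compm_idr -[X in _ \oc X = _]zigzag !compm_assoc.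
  by rewrite runitorK compm_idl.
rewrite runitorV_zigzag.
have tens_idl a b c (f : hom b c) (g : hom a b) :
    idm w \otm (f \oc g) = (idm w \otm f) \oc (idm w \otm g).
  by rewrite -tensm_comp compm_idl.
have tens_idr a b c (f : hom b c) (g : hom a b) :
    (f \oc g) \otm idm x = (f \otm idm x) \oc (g \otm idm x).
  by rewrite -tensm_comp compm_idl.
rewrite !tens_idl !tens_idr.
rewrite -[LHS]compm_idl -(associatorK w x one) -compm_assoc; congr (_ \oc _).
rewrite -tensm_id !compm_assoc associator_nat.
rewrite -(compm_assoc (idm w \otm (idm x \otm ev))) pentagon.
rewrite -!compm_assoc; congr (_ \oc (_ \oc _)).
rewrite (compm_assoc (associator w x x' \otm idm x)) -tens_idr associatorVK.
rewrite tensm_id compm_idl compm_assoc associator_nat -compm_assoc.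
congr (_ \oc _).
have triangleV :
    idm w \otm lunitor x \oc (associator w one x \oc runitorV w \otm idm x) =
    idm (w \otimes x).
  by rewrite compm_assoc triangle -tens_idr runitorVK tensm_id.
by rewrite -[RHS]compm_idr -triangleV compm_assoc -tens_idl lunitorK tensm_id
  compm_idl.
Qed.

(** Transposing back gives [f \otm idm one] up to an isomorphism of the source,
   by the zigzag identity, and the right unitor recovers [f] from it. *)
Lemma transpose_inj w z (f : hom (w \otimes x) z) : transpose f = 0 -> f = 0.
Proof.
move=> tf0.
have untranspose : f \otm idm one
      \oc (associatorV w x one \oc (idm w \otm runitorV x)) =
    idm z \otm ev \oc associator z x' x \oc (transpose f \otm idm x).
  rewrite -zigzag_tensl !compm_assoc -tensm_comp compm_idl compm_idr.
  rewrite /transpose.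
  have -> (h : hom w ((w \otimes x) \otimes x')) :
      (f \otm idm x' \oc h) \otm idm x =
      (f \otm idm x') \otm idm x \oc (h \otm idm x).
    by rewrite -tensm_comp compm_idl.
  rewrite !compm_assoc -(compm_assoc (idm z \otm ev)) associator_nat.
  rewrite !compm_assoc -tensm_comp tensm_id compm_idl compm_idr.
  by [].
rewrite tf0 tens0m compm0 in untranspose.
have f1 : f \otm idm one = 0.
  rewrite -[LHS]compm_idr -(associatorK w x one) -[associator w x one]compm_idl.
  rewrite -(tensm_id w) -(runitorK x) -[idm w]compm_idl tensm_comp.
  by rewrite !compm_assoc -(compm_assoc (f \otm idm one)) untranspose !comp0m.
rewrite -[f]compm_idr -(runitorVK (w \otimes x)) compm_assoc -runitor_nat.
by rewrite f1 compm0 comp0m.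
Qed.

Lemma leq_dim_transpose w z :
  (dim (hom (w \otimes x) z) <= dim (hom w (z \otimes x')))%N.
Proof.
apply: (@leq_dim_linear _ _ _ (@transpose w z)); last exact: transpose_inj.
by move=> a f g; rewrite /transpose tensm_linearl compm_linearl.
Qed.

End Transposition.
End Monoidal.

(** * Fusion coefficients of a self-dual fusion category *)

Section FusionCoefficients.
Variables (k : closedFieldType) (C : fusionCategory k).
Hypothesis self_dual_C : self_dual C.
Variable s : seq C.
Hypothesis irr_s : is_Irr s.
Implicit Types (u v w x y z : C).
Local Notation one := (unit_obj C).
Local Notation irr i := (nth (zero C) s i).

Let abC := fusion_abelian C.
Let ssC := fusion_semisimple (f := C).
Let dim_homCC := dim_homC abC ssC irr_s.

Lemma additive_eq (phi psi : C -> nat) :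
    additive_on_objects phi -> additive_on_objects psi ->
    (forall x, is_simple x -> phi x = psi x) -> forall x, phi x = psi x.
Proof.
move=> phi_add psi_add eq_simple x.
rewrite (additive_decomposition abC ssC irr_s x phi_add).
rewrite (additive_decomposition abC ssC irr_s x psi_add).
by apply: eq_bigr => i _; rewrite eq_simple //; apply: simple_irr.
Qed.

(** Transposition gives an inequality between the two sides; since
   dimensions of Hom spaces are symmetric, it also gives the converse. *)
Lemma dim_hom_tens_simple w x y : is_simple x ->
  dim (hom (w \otimes x) y) = dim (hom w (y \otimes x)).
Proof.
move=> simple_x.
have le_dim a b : dim (hom (a \otimes x) b) <= dim (hom a (b \otimes x)).
  apply: leq_trans (leq_dim_transpose (ldualP x) a b) _.
  have iso_b := tens_cong (isomorphic_refl b) (self_dual_C simple_x).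
  by rewrite (dim_hom_isor a iso_b) leqnn.
apply/eqP; rewrite eqn_leq le_dim /= dim_homCC.
by rewrite [leqRHS]dim_homCC le_dim.
Qed.

Lemma dim_hom_tens_unit x y : is_simple y ->
  dim (hom (x \otimes y) one) = dim (hom y x).
Proof.
move=> simple_y; rewrite dim_hom_tens_simple // dim_homCC.
exact: dim_hom_isol (unit_tens y).
Qed.

Lemma dim_hom_unit_tens x y : is_simple x ->
  dim (hom (x \otimes y) one) = dim (hom x y).
Proof.
move=> simple_x; move: y; apply: additive_eq.
- exact: additive_tensr (additive_dim_homl one).
- exact: additive_dim_homr.
by move=> y simple_y; rewrite dim_hom_tens_unit // dim_homCC.
Qed.

Lemma fusion_swap u v w : is_simple v ->
  dim (hom w (u \otimes v)) = dim (hom u (w \otimes v)).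
Proof. by move=> simple_v; rewrite dim_homCC dim_hom_tens_simple. Qed.

(** Both sides are the multiplicity of the unit in [u \otimes v \otimes w],
   bracketed in the two possible ways. *)
Lemma fusion_rotate u v w : is_simple u -> is_simple w ->
  dim (hom w (u \otimes v)) = dim (hom u (v \otimes w)).
Proof.
move=> simple_u simple_w.
rewrite -dim_hom_tens_unit // -[RHS]dim_hom_unit_tens //.
exact: dim_hom_isol (tens_assoc u v w).
Qed.

Lemma fusionC u v : is_simple u -> is_simple v ->
  u \otimes v \cong v \otimes u.
Proof.
move=> simple_u simple_v; apply: (iso_dim_hom abC ssC irr_s) => i lt_i.
have simple_i : is_simple (irr i) by have [/(_ i lt_i)[]] := irr_s.
by rewrite fusion_swap // fusion_rotate.
Qed.

End FusionCoefficients.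

(** * Rank four with a Fibonacci subcategory *)

Section RankFour.
Variables (k : closedFieldType) (C : fusionCategory k).
Hypothesis self_dual_C : self_dual C.
Variables X Y Z : C.
Hypothesis irr_C : is_Irr [:: unit_obj C; X; Y; Z].
Hypothesis fib_Z : Z \otimes Z \cong unit_obj C \oplus Z.
Implicit Types U V W : C.
Local Notation one := (unit_obj C).
Local Notation mult U V := (dim (hom U V)).
Local Notation irr i := (nth (zero C) [:: one; X; Y; Z] i).

Let simple_irr4 i : i < 4 -> is_simple (irr i).
Proof. by have [simple_s _ _] := irr_C => /simple_s[]. Qed.

Let simple_one : is_simple one. Proof. exact: (@simple_irr4 0). Qed.
Let simple_X : is_simple X. Proof. exact: (@simple_irr4 1). Qed.
Let simple_Y : is_simple Y. Proof. exact: (@simple_irr4 2). Qed.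
Let simple_Z : is_simple Z. Proof. exact: (@simple_irr4 3). Qed.

Let mult_irr i j : i < 4 -> j < 4 -> mult (irr i) (irr j) = (i == j).
Proof.
move=> lt_i lt_j.
exact: (dim_hom_irr (fusion_abelian C) irr_C (Ordinal lt_i) (Ordinal lt_j)).
Qed.

Let mult_simples :=
  (((@mult_irr 0 0 isT isT, @mult_irr 0 1 isT isT),
    (@mult_irr 0 2 isT isT, @mult_irr 0 3 isT isT)),
   ((@mult_irr 1 0 isT isT, @mult_irr 1 1 isT isT),
    (@mult_irr 1 2 isT isT, @mult_irr 1 3 isT isT)),
   ((@mult_irr 2 0 isT isT, @mult_irr 2 1 isT isT),
    (@mult_irr 2 2 isT isT, @mult_irr 2 3 isT isT)),
   ((@mult_irr 3 0 isT isT, @mult_irr 3 1 isT isT),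
    (@mult_irr 3 2 isT isT, @mult_irr 3 3 isT isT))).

Let iso_mult V W : mult one V = mult one W -> mult X V = mult X W ->
  mult Y V = mult Y W -> mult Z V = mult Z W -> V \cong W.
Proof.
move=> eq1 eqX eqY eqZ.
apply: (iso_dim_hom (fusion_abelian C) (fusion_semisimple (f := C)) irr_C).
by case=> [|[|[|[|i]]]].
Qed.

Let swap U V W : is_simple V -> mult W (U \otimes V) = mult U (W \otimes V).
Proof. exact: (fusion_swap self_dual_C irr_C). Qed.

Let rotate U V W : is_simple U -> is_simple W ->
  mult W (U \otimes V) = mult U (V \otimes W).
Proof. exact: (fusion_rotate self_dual_C irr_C). Qed.

Let mult_biprod U V W : mult U (V \oplus W) = mult U V + mult U W.
Proof. exact: dim_hom_biprodr. Qed.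

Let mult_copies U n V : mult U (n \cdot V) = n * mult U V.
Proof. exact: (additive_copies n V (additive_dim_homr U)). Qed.

Let mult_biprod_tens U V V' W :
  mult U ((V \oplus V') \otimes W) =
  mult U (V \otimes W) + mult U (V' \otimes W).
Proof. by have [_ ->] := additive_tensl W (additive_dim_homr U). Qed.

Let mult_copies_tens U n V W :
  mult U ((n \cdot V) \otimes W) = n * mult U (V \otimes W).
Proof.
exact: (additive_copies n V (additive_tensl W (additive_dim_homr U))).
Qed.

Let multE := (mult_biprod, mult_copies, mult_biprod_tens, mult_copies_tens).

Let mult_unit_tens U V : mult U (one \otimes V) = mult U V.
Proof. exact: dim_hom_isor (unit_tens V). Qed.

Let mult_tens_unit U V : mult U (V \otimes one) = mult U V.
Proof. exact: dim_hom_isor (tens_unit V). Qed.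

Let mult_ZZ V : mult V (Z \otimes Z) = mult V one + mult V Z.
Proof. by rewrite (dim_hom_isor V fib_Z) multE. Qed.

Lemma tens_Z_decomp V : is_simple V -> mult V one = 0 -> mult V Z = 0 ->
  V \otimes Z \cong
    mult X (V \otimes Z) \cdot X \oplus mult Y (V \otimes Z) \cdot Y.
Proof.
move=> simple_V V1 VZ; apply: iso_mult; rewrite !multE !mult_simples /=.
- by rewrite rotate // mult_tens_unit VZ !muln0.
- by rewrite muln1 muln0 addn0.
- by rewrite muln1 muln0.
- by rewrite rotate // mult_ZZ V1 VZ !muln0.
Qed.

(** [Z] acts on the span of [X] and [Y] by a symmetric matrix with natural
   entries that squares to itself plus the identity. *)
Lemma tens_Z_coefficients :
  [/\ mult X (X \otimes Z) + mult Y (Y \otimes Z) = 1,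
      mult Y (X \otimes Z) = 1 & mult X (Y \otimes Z) = 1].
Proof.
have XZ : mult X Z = 0 := @mult_irr 1 3 isT isT.
have X1 : mult X one = 0 := @mult_irr 1 0 isT isT.
have YZ : mult Y Z = 0 := @mult_irr 2 3 isT isT.
have Y1 : mult Y one = 0 := @mult_irr 2 0 isT isT.
have square U V : is_simple V -> mult V one = 0 -> mult V Z = 0 ->
  mult X (V \otimes Z) * mult U (X \otimes Z) +
  mult Y (V \otimes Z) * mult U (Y \otimes Z) = mult U V + mult U (V \otimes Z).
  move=> simple_V V1 VZ; rewrite -!mult_copies_tens -mult_biprod_tens.
  have VZ_decomp := tens_Z_decomp simple_V V1 VZ.
  rewrite -(dim_hom_isor U (tens_cong VZ_decomp (isomorphic_refl Z))).
  rewrite (dim_hom_isor U (tens_assoc V Z Z)).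
  rewrite (dim_hom_isor U (tens_cong (isomorphic_refl V) fib_Z)).
  by rewrite (dim_hom_isor U (tens_biprodr _ _ _)) mult_biprod mult_tens_unit.
have := (square X X simple_X X1 XZ, square Y X simple_X X1 XZ,
         square Y Y simple_Y Y1 YZ).
rewrite !mult_simples /= (swap X Y simple_Z).
move: (mult X (X \otimes Z)) (mult X (Y \otimes Z)) (mult Y (Y \otimes Z)).
move=> al be de [[alal albe] dede].
(* If [be] were zero, [al] would be a root of t^2 = 1 + t, hence irrational. *)
have be_gt0 : 0 < be by case: be al alal {albe dede} => [|be] [|[|al]]; nia.
have trace1 : al + de = 1 by apply/eqP; rewrite -(eqn_pmul2r be_gt0); lia.
suff -> : be = 1 by [].
have al01 : al = 0 \/ al = 1 by lia.
by case: al01 => al_eq; nia.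
Qed.

Lemma mult_tens_Y U V : X \otimes Z \cong Y ->
  mult U (V \otimes Y) = mult U ((V \otimes X) \otimes Z).
Proof.
move=> XZ_Y; rewrite (dim_hom_isor U (tens_assoc _ _ _)).
exact: dim_hom_isor (tens_cong (isomorphic_refl V) (isomorphic_sym XZ_Y)).
Qed.

Lemma fusion_rules_oriented : mult X (X \otimes Z) = 0 ->
  exists a b : nat,
    X \otimes X \cong one \oplus a \cdot X \oplus b \cdot Y /\
    X \otimes Y \cong b \cdot X \oplus (a + b) \cdot Y \oplus Z /\
    X \otimes Z \cong Y /\
    Y \otimes Z \cong X \oplus Y /\
    Y \otimes Y \cong
      one \oplus (a + b) \cdot X \oplus (a + 2 * b) \cdot Y \oplus Z.
Proof.
move=> XZ_X; have [YZ_Y XZ_Y YZ_X] := tens_Z_coefficients.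
rewrite XZ_X add0n in YZ_Y.
have XZ_Z : mult Z (X \otimes Z) = 0 by rewrite rotate // mult_ZZ !mult_simples.
have YZ_Z : mult Z (Y \otimes Z) = 0 by rewrite rotate // mult_ZZ !mult_simples.
have XZ : X \otimes Z \cong Y.
  apply: iso_mult; rewrite ?XZ_X ?XZ_Y ?XZ_Z !mult_simples //=.
  by rewrite rotate // mult_tens_unit !mult_simples.
have YZ : Y \otimes Z \cong X \oplus Y.
  apply: iso_mult; rewrite ?YZ_X ?YZ_Y ?YZ_Z !multE !mult_simples //=.
  by rewrite rotate // mult_tens_unit !mult_simples.
pose a := mult X (X \otimes X); pose b := mult Y (X \otimes X).
have XX : X \otimes X \cong one \oplus a \cdot X \oplus b \cdot Y.
  apply: iso_mult; rewrite !multE !mult_simples /= ?muln0 ?muln1 ?addn0 //.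
    by rewrite rotate // mult_tens_unit !mult_simples.
  by rewrite rotate // XZ_X.
have XY_Y : mult Y (X \otimes Y) = a + b.
  rewrite mult_tens_Y // (dim_hom_isor Y (tens_cong XX (isomorphic_refl Z))).
  by rewrite !multE mult_unit_tens !mult_simples XZ_Y YZ_Y !muln1.
have XY : X \otimes Y \cong b \cdot X \oplus (a + b) \cdot Y \oplus Z.
  apply: iso_mult; rewrite !multE !mult_simples /= ?muln0 ?muln1 ?addn0 //.
  - by rewrite rotate // mult_tens_unit !mult_simples.
  - by rewrite rotate // -swap.
  - by rewrite rotate // YZ_X.
have YY_Y : mult Y (Y \otimes Y) = a + 2 * b.
  rewrite mult_tens_Y //.
  have YX := isomorphic_trans
    (fusionC self_dual_C irr_C simple_Y simple_X) XY.
  rewrite (dim_hom_isor Y (tens_cong YX (isomorphic_refl Z))).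
  by rewrite !multE mult_ZZ !mult_simples XZ_Y YZ_Y /=; lia.
exists a, b; do 4!split=> //.
apply: iso_mult; rewrite !multE !mult_simples /= ?muln0 ?muln1 ?addn0 //.
- by rewrite rotate // mult_tens_unit !mult_simples.
- by rewrite rotate // rotate // XY_Y.
- by rewrite rotate // YZ_Y.
Qed.

End RankFour.

(** The order of [X] and [Y] is what distinguishes the two solutions for
   [- \otimes Z]; exchanging them reduces one to the other. *)
Lemma Irr_swap (k : fieldType) (C : additiveCategory k) (V X Y Z : C) :
  is_Irr [:: V; X; Y; Z] -> is_Irr [:: V; Y; X; Z].
Proof.
pose t i := match i with 1 => 2 | 2 => 1 | _ => i end.
have tK : involutive t by do 3?case.
have lt_t i : (t i < 4) = (i < 4) by do 3?case: i => [|i].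
have nth_t i : nth (zero C) [:: V; Y; X; Z] i =
    nth (zero C) [:: V; X; Y; Z] (t i).
  by do 3?case: i => [|i].
move=> [simple_s inj_s all_s]; split=> [i | i j | x simple_x _].
- by rewrite nth_t -lt_t; apply: simple_s.
- rewrite !nth_t -(lt_t i) -(lt_t j) => lt_i lt_j /(inj_s _ _ lt_i lt_j).
  exact: can_inj tK _ _.
have [i lt_i iso_xi] := all_s x simple_x I.
by exists (t i); rewrite ?lt_t // nth_t tK.
Qed.

Theorem proposition3p3 (k : closedFieldType)
    (hk : [pchar k]%R =i pred0)
    (C : fusionCategory k) (hsd : self_dual C) (hrank : has_rank C 4)
    (X Y Z : C) (hIrr : is_Irr [:: unit_obj C; X; Y; Z])
    (hFib : generates_Fibonacci Z) :
  exists (a b : nat) (X' Y' : C),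
    ((X' = X /\ Y' = Y) \/ (X' = Y /\ Y' = X)) /\
    (X' \otimes X' \cong unit_obj C \oplus a \cdot X' \oplus b \cdot Y' /\
     X' \otimes Y' \cong b \cdot X' \oplus (a + b) \cdot Y' \oplus Z /\
     X' \otimes Z \cong Y' /\
     Y' \otimes Z \cong X' \oplus Y' /\
     Y' \otimes Y' \cong
       unit_obj C \oplus (a + b) \cdot X' \oplus (a + 2 * b) \cdot Y' \oplus Z /\
     Z \otimes Z \cong unit_obj C \oplus Z /\
     (forall V W : C, is_simple V -> is_simple W -> V \otimes W \cong W \otimes V)).
Proof.
have [_ _ fib_Z] := hFib.
have comm V W (sV : is_simple V) (sW : is_simple W) := fusionC hsd hIrr sV sW.
have [coef_XY _ _] := tens_Z_coefficients hsd hIrr fib_Z.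
have [XZ_X | YZ_Y] :
    dim (hom X (X \otimes Z)) = 0 \/ dim (hom Y (Y \otimes Z)) = 0 by lia.
- have [a [b [XX [XY [XZ [YZ YY]]]]]] :=
    fusion_rules_oriented hsd hIrr fib_Z XZ_X.
  by exists a, b, X, Y; split; [left | do 6!split=> //].
have [a [b [YY [YX [YZ [XZ XX]]]]]] :=
  fusion_rules_oriented hsd (Irr_swap hIrr) fib_Z YZ_Y.
by exists a, b, Y, X; split; [right | do 6!split=> //].
Qed.
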